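(* Let $X_1,\dots,X_n$ be $d\times d$ positive semidefinite matrices, let $\{\alpha_t:1\le t\le n\}$ be a probability distribution, and let $f:[0,\infty)\to[0,+\infty)$ be a convex function. Then $$\sum_{k\in K}\lambda_k^\downarrow\Bigl(f\bigl(\textstyle\sum_{t=1}^n\alpha_tX_t\bigr)\Bigr)\le\sum_{t=1}^n\alpha_t\sum_{i_t\in I_t}\lambda_{i_t}^\downarrow\bigl(f(X_t)\bigr)$$ for all Horn tuples $(I_1,\dots,I_n;K)$ in dimension $d$. Equivalently, there exist $d\times d$ unitaries $U_1,\dots,U_n$ such that $$f\Bigl(\sum_t\alpha_tX_t\Bigr)\le\sum_t\alpha_tU_tf(X_t)U_t^\dagger .$$
   Context: $f(X)$ is defined by functional calculus; $\le$ between Hermitian matrices is the Loewner order; $\lambda_1^\downarrow(A)\ge\lambda_2^\downarrow(A)\ge\cdots$ are the eigenvalues of a Hermitian matrix $A$ in decreasing order. $[d]=\{1,\dots,d\}$; $\mathrm{Gr}(r,d)$ is the set of $r$-dimensional subspaces of $\mathbb{C}^d$. For $I=\{i_1<\dots<i_r\}\subset[d]$, $I^\vee=\{d+1-i_r<\dots<d+1-i_1\}$. For a complete flag $E_\bullet=(E_1\subset\cdots\subset E_d=\mathbb{C}^d)$, $$\Omega_I(E_\bullet)=\{L\in\mathrm{Gr}(r,d):\dim(L\cap E_{i_q})\ge q\text{ for }q=1,\dots,r\}.$$ An $(n+1)$-tuple $(I_1,\dots,I_n;K)$ of $r$-subsets of $[d]$ is a Horn tuple of rank $r$ in dimension $d$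 if $$\Omega_{I_1^\vee}(E_\bullet^{(1)})\cap\cdots\cap\Omega_{I_n^\vee}(E_\bullet^{(n)})\cap\Omega_K(G_\bullet)\ne\varnothing$$ for every choice of complete flags $E_\bullet^{(1)},\dots,E_\bullet^{(n)},G_\bullet$ in $\mathbb{C}^d$. A Horn tuple in dimension $d$ is one of any rank $1\le r\le d$. *)

(* Defs.v *)
From mathcomp Require Import all_boot all_order all_algebra.
From mathcomp Require Import complex.
From mathcomp Require Import boolp classical_sets set_interval reals interval_inference convex.

Set Implicit Arguments.
Unset Strict Implicit.
Unset Printing Implicit Defensive.

Import Order.TTheory GRing.Theory Num.Theory.
Local Open Scope ring_scope.
Local Open Scope complex_scope.
Local Open Scope sesquilinear_scope.

(* Indices are 0-based: [d] is 'I_d, so that i : 'I_d is the element i + 1. *)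

Section HermitianMatrices.
Context {R : realType} {d : nat}.
Implicit Types (A B : 'M[R[i]]_d) (f : R -> R).

Definition psdmx A : Prop :=
  A \is hermsymmx /\ forall v : 'cV[R[i]]_d, 0 <= (v^t* *m A *m v) 0 0.

Definition loewner_le A B : Prop := psdmx (B - A).

(* For Hermitian A, MathComp's spectral theorem reads
     A = invmx (spectralmx A) *m diag_mx (spectral_diag A) *m spectralmx A
   with spectralmx A unitary and spectral_diag A real; both are junk values
   when A is not normal. *)
Definition mxfun f A : 'M[R[i]]_d :=
  invmx (spectralmx A)
  *m diag_mx (\row_j (f (complex.Re (spectral_diag A 0 j)))%:C)
  *m spectralmx A.

(* eigval_desc A k is the (k + 1)-st largest eigenvalue of the Hermitian matrix
   A, counted with multiplicity. *)
Definition eigval_desc A (k : 'I_d) : R :=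
  nth 0 (sort >=%R [seq complex.Re (spectral_diag A 0 j) | j <- enum 'I_d]) k.

End HermitianMatrices.

Section HornTuples.
Context {R : realType} {d : nat}.
Implicit Types (I K : {set 'I_d}) (E G : 'I_d -> {vspace 'cV[R[i]]_d}).

(* rev_ord i = d - 1 - i is d + 1 - i in 1-based numbering. *)
Definition dual_index I : {set 'I_d} := [set rev_ord i | i in I].

Definition complete_flag E : Prop :=
  (forall i, \dim (E i) = i.+1) /\
  (forall i j : 'I_d, (i <= j)%N -> (E i <= E j)%VS).

(* enum lists ordinals increasingly, hence enum_val q is the (q + 1)-st smallest
   element of I. *)
Definition schubert I E (L : {vspace 'cV[R[i]]_d}) : Prop :=
  \dim L = #|I| /\
  forall q : 'I_#|I|, (q.+1 <= \dim (L :&: E (enum_val q)))%N.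

End HornTuples.

Definition horn_tuple_rank (R : realType) (d n r : nat)
    (I : 'I_n -> {set 'I_d}) (K : {set 'I_d}) : Prop :=
  [/\ forall t, #|I t| = r, #|K| = r &
      forall (E : 'I_n -> 'I_d -> {vspace 'cV[R[i]]_d})
             (G : 'I_d -> {vspace 'cV[R[i]]_d}),
        (forall t, complete_flag (E t)) -> complete_flag G ->
        exists L : {vspace 'cV[R[i]]_d},
          (forall t, schubert (dual_index (I t)) (E t) L) /\ schubert K G L].

Definition horn_tuple (R : realType) (d n : nat)
    (I : 'I_n -> {set 'I_d}) (K : {set 'I_d}) : Prop :=
  exists r : nat, (1 <= r <= d)%N /\ horn_tuple_rank R r I K.

(* Main.v *)
(* Put M = sum_t alpha_t X_t and let V+, V- be frames of eigenvectors of M, an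
   eigenvalue mu being put in V+ when f is nondecreasing on [mu, oo), and in V-
   otherwise, in which case f is nonincreasing on [0, mu]. Let f+ <= f and
   f- <= f be the greatest nondecreasing and nonincreasing minorants of f; they
   are convex. In the block decomposition V+ (+) V-, let Y_t be the block
   diagonal matrix f+(V+* X_t V+) (+) f-(V-* X_t V-). The matrix Jensen
   inequality for monotone convex functions, applied in each block, bounds f(M)
   by a unitary conjugate of sum_t alpha_t Y_t. By Cauchy interlacing, and since
   f+(x) > s and f-(x) > s happen simultaneously only if f > s everywhere, Y_t
   has at most as many eigenvalues > s as f(X_t), for every s; hence
   Y_t <= U_t f(X_t) U_t^*.
   The Horn inequalities follow by taking flags of eigenvectors of f(M) and of
   the U_t f(X_t) U_t^*, and comparing traces of compressions to a subspace in
   the intersection of the Schubert varieties (Hersch-Zwahlen). *)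

Require Import Defs.
From mathcomp Require Import all_boot all_order all_algebra.
From mathcomp Require Import complex.
From mathcomp Require Import boolp classical_sets set_interval reals interval_inference convex.
From mathcomp Require Import perm lra ring.

Import Order.TTheory GRing.Theory Num.Theory.
Local Open Scope ring_scope.
Local Open Scope complex_scope.
Local Open Scope sesquilinear_scope.

Set Implicit Arguments.
Unset Strict Implicit.
Unset Printing Implicit Defensive.

(** * Convex functions on the half-line *)

Section WeightedMeans.
Context {R : realType}.
Implicit Types (g : R -> R) (P : R -> Prop).

Definition convex_nneg g := forall x y t, 0 <= x -> 0 <= y -> 0 <= t -> t <= 1 ->
  g (t * x + (1 - t) * y) <= t * g x + (1 - t) * g y.

(** The part of [P] in the half-line is an interval, with no condition on endpoints. Superlevel sets
    of monotone functions, sublevel sets of convex ones and complements of half-lines are thus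
    treated alike. *)
Definition interval_nneg P :=
  forall x y z, 0 <= x -> x <= y -> y <= z -> P x -> P z -> P y.

(** The weights are not normalised, so squared moduli of coordinates can be used directly and
    Rayleigh quotients become instances. For total weight zero the value is 0. *)
Definition wmean (T : finType) (w c : T -> R) := (\sum_i w i * c i) / \sum_i w i.

Lemma wmean_ge0 (T : finType) (w c : T -> R) :
  (forall i, 0 <= w i) -> (forall i, 0 <= c i) -> 0 <= wmean w c.
Proof.
move=> w0 c0; apply: divr_ge0; last exact: sumr_ge0.
by apply: sumr_ge0 => i _; apply: mulr_ge0.
Qed.

(** The mean lies between the least and the greatest [c i] of nonzero weight, and both of these
    satisfy [P]. *)
Lemma wmean_interval P (T : finType) (w c : T -> R) :
  interval_nneg P -> (forall i, 0 <= w i) -> (forall i, 0 <= c i) ->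
  0 < \sum_i w i -> (forall i, w i != 0 -> P (c i)) -> P (wmean w c).
Proof.
move=> IP w0 c0 W0 wP.
have [i0 wi0] : exists i, w i != 0.
  apply/existsP; apply: contraTT W0 => /existsPn wz.
  by rewrite -leNgt big1 // => i _; apply/eqP; rewrite -[_ == _]negbK wz.
case: (arg_minP c (P := fun i => w i != 0) wi0) => i wi ci.
case: (arg_maxP c (P := fun i => w i != 0) wi0) => j wj cj.
have bnd k : w k * c i <= w k * c k <= w k * c j.
  have [->|wk] := eqVneq (w k) 0; first by rewrite !mul0r lexx.
  by apply/andP; split; apply: ler_wpM2l => //; [exact: ci|exact: cj].
apply: (IP (c i) _ (c j)) => //; try exact: wP.
  by rewrite ler_pdivlMr // mulrC mulr_suml; apply: ler_sum => k _; case/andP: (bnd k).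
by rewrite ler_pdivrMr // mulrC mulr_suml; apply: ler_sum => k _; case/andP: (bnd k).
Qed.

(** Induction on the list: the mean of [i :: s] is the convex combination of [c i] and the mean of
    [s] with weight [w i / (w i + W)], where [W] is the weight of [s]. *)
Lemma jensen_seq g (T : Type) (w c : T -> R) (s : seq T) :
  convex_nneg g -> (forall i, 0 <= w i) -> (forall i, 0 <= c i) ->
  0 < \sum_(i <- s) w i ->
  g ((\sum_(i <- s) w i * c i) / \sum_(i <- s) w i) * (\sum_(i <- s) w i)
    <= \sum_(i <- s) w i * g (c i).
Proof.
move=> cg w0 c0; elim: s => [|i s IH]; first by rewrite big_nil ltxx.
rewrite !big_cons => W0.
have Ws0 : 0 <= \sum_(j <- s) w j by exact: sumr_ge0.
(* A tail of weight zero has no meaningful mean, but then each of its terms vanishes. *)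
have [Wz|Wn0] := eqVneq (\sum_(j <- s) w j) 0.
  have sum0 (h : T -> R) : \sum_(j <- s) w j * h j = 0.
    elim: s Wz {IH W0 Ws0} => [|j s IHs]; rewrite ?big_nil // !big_cons => /eqP.
    rewrite paddr_eq0 ?sumr_ge0 // => /andP[/eqP-> /eqP/IHs->].
    by rewrite mul0r addr0.
  rewrite !sum0 Wz !addr0 in W0 *.
  by rewrite mulrAC divff ?gt_eqF // mul1r mulrC.
have Wp : 0 < \sum_(j <- s) w j by rewrite lt_def Wn0.
have {}IH := IH Wp.
set W := \sum_(j <- s) w j in W0 Ws0 Wn0 Wp IH *.
set S := \sum_(j <- s) w j * c j in IH *.
have S0 : 0 <= S by apply: sumr_ge0 => k _; apply: mulr_ge0.
have := cg (c i) (S / W) (w i / (w i + W)) (c0 i) (divr_ge0 S0 Ws0).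
have -> : w i / (w i + W) * c i + (1 - w i / (w i + W)) * (S / W)
   = (w i * c i + S) / (w i + W) by field; rewrite Wn0 gt_eqF.
have t0 : 0 <= w i / (w i + W) by rewrite divr_ge0 // ltW.
have t1 : w i / (w i + W) <= 1 by rewrite ler_pdivrMr // mul1r lerDl.
move=> /(_ t0 t1) cgi; rewrite -(ler_pM2r W0) in cgi; apply: (le_trans cgi).
have -> : (w i / (w i + W) * g (c i) + (1 - w i / (w i + W)) * g (S / W)) * (w i + W)
   = w i * g (c i) + g (S / W) * W by field; rewrite gt_eqF.
by rewrite lerD2l.
Qed.

Lemma jensen g (T : finType) (w c : T -> R) :
  convex_nneg g -> (forall i, 0 <= w i) -> (forall i, 0 <= c i) ->
  0 < \sum_i w i ->
  g (wmean w c) * (\sum_i w i) <= \sum_i w i * g (c i).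
Proof. exact: jensen_seq. Qed.

Lemma convex_nneg_interval_le g s : convex_nneg g -> interval_nneg (fun x => g x <= s).
Proof.
move=> cg x y z x0 xy yz gx gz.
have [e|xz] := eqVneq x z.
  by have -> : y = x by apply/le_anti; rewrite xy e yz.
have xltz : 0 < z - x by rewrite subr_gt0 lt_neqAle xz (le_trans xy).
(* The coefficient that writes [y] as a convex combination of [x] and [z]. *)
have := cg x z ((z - y) / (z - x)) x0 (le_trans x0 (le_trans xy yz)).
have t0 : 0 <= (z - y) / (z - x) by rewrite divr_ge0 ?subr_ge0 // (le_trans xy).
have t1 : (z - y) / (z - x) <= 1 by rewrite ler_pdivrMr // mul1r lerD2l lerN2.
move=> /(_ t0 t1).
have -> : (z - y) / (z - x) * x + (1 - (z - y) / (z - x)) * z = y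
  by field; rewrite gt_eqF.
move=> /le_trans; apply.
move: t0 t1; set t := _ / _ => t0 t1; nra.
Qed.

End WeightedMeans.

(** * Monotone minorants of a convex function *)

Section MonotoneEnvelope.
Context {R : realType}.
Variables (f : R -> R) (r : R -> R -> Prop).
Hypotheses (f_ge0 : forall x : R, 0 <= x -> 0 <= f x) (f_cvx : convex_nneg f).

(** On the half-line this is the greatest nondecreasing minorant of [f] when [r x y] is [x <= y],
    and the greatest nonincreasing one when it is [y <= x]. The parameter [r] lets the two share
    their lemmas. *)
Definition envelope (x : R) : R := inf [set f y | y in [set y | 0 <= y /\ r x y]]%classic.

Hypothesis r_refl : forall x, r x x.

Lemma envelope_has_inf x : 0 <= x -> has_inf [set f y | y in [set y | 0 <= y /\ r x y]]%classic.
Proof.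
move=> x0; split; first by exists (f x); exists x.
by exists 0 => _ [y [y0 _] <-]; apply: f_ge0.
Qed.

Lemma envelope_le x y : 0 <= x -> 0 <= y -> r x y -> envelope x <= f y.
Proof.
move=> x0 y0 rxy; apply: inf_lbound; last by exists y.
by case: (envelope_has_inf x0).
Qed.

Lemma envelope_ge x m :
  0 <= x -> (forall y, 0 <= y -> r x y -> m <= f y) -> m <= envelope x.
Proof.
move=> x0 mf; apply: lb_le_inf; first by case: (envelope_has_inf x0).
by move=> _ [y [y0 rxy] <-]; apply: mf.
Qed.

Lemma envelope_lt x s : 0 <= x -> envelope x < s -> exists2 y, 0 <= y /\ r x y & f y < s.
Proof.
move=> x0 /(inf_lt (envelope_has_inf x0).1)[_ [y rxy <-] fys].
by exists y.
Qed.

(** Partial minimisation over a convex relation: near-minimisers for [x1] and [x2] combine to a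
    competitor for the combined point. The slack [e] is there because the infimum need not be
    attained. *)
Lemma envelope_convex :
  (forall x1 x2 y1 y2 t, 0 <= t -> t <= 1 -> r x1 y1 -> r x2 y2 ->
     r (t * x1 + (1 - t) * x2) (t * y1 + (1 - t) * y2)) ->
  convex_nneg envelope.
Proof.
move=> r_cvx x1 x2 t x10 x20 t0 t1; apply/ler_addgt0Pr => e e0.
have lt1 : envelope x1 < envelope x1 + e by rewrite ltrDl.
have lt2 : envelope x2 < envelope x2 + e by rewrite ltrDl.
have [y1 [y10 r1] f1] := envelope_lt x10 lt1.
have [y2 [y20 r2] f2] := envelope_lt x20 lt2.
have nn a b : 0 <= a -> 0 <= b -> 0 <= t * a + (1 - t) * b.
  by move=> a0 b0; rewrite addr_ge0 ?mulr_ge0 // subr_ge0.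
apply: (le_trans (envelope_le (nn _ _ x10 x20) (nn _ _ y10 y20) (r_cvx _ _ _ _ _ t0 t1 r1 r2))).
apply: (le_trans (f_cvx y10 y20 t0 t1)).
move: f1 f2; nra.
Qed.

End MonotoneEnvelope.

(** A descent [f z < f y] with [x <= y <= z] propagates to the left. For [u <= v <= x],
    quasi-convexity on [u, y, z] gives [f y <= f u], and on [u, v, y] it then gives [f v <= f u]. *)
Lemma convex_nneg_dichotomy (R : realType) (f : R -> R) (x : R) : convex_nneg f -> 0 <= x ->
  (forall y z, x <= y -> y <= z -> f y <= f z) \/
  (forall y z, 0 <= y -> y <= z -> z <= x -> f z <= f y).
Proof.
move=> cf x0; have [inc|/existsNP[y /existsNP[z]]] :=
  pselect (forall y z, x <= y -> y <= z -> f y <= f z); first by left.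
move=> /not_implyP[xy] /not_implyP[yz] /negP; rewrite -ltNge => fzy; right => u v u0 uv vx.
have vy := le_trans vx xy.
have lemax a b c : 0 <= a -> a <= b -> b <= c -> f b <= f a \/ f b <= f c.
  move=> a0 ab bc; have := @convex_nneg_interval_le _ f (Num.max (f a) (f c)) cf a b c a0 ab bc.
  by rewrite !le_max !lexx orbT => /(_ isT isT) /orP.
case: (lemax u v y u0 uv vy) => // fvy.
case: (lemax u y z u0 (le_trans uv vy) yz); last by rewrite leNgt fzy.
exact: le_trans.
Qed.

(** * Hermitian matrices and their quadratic forms *)

(* The carrier of A^t* is elaborated through the closed field structure of R[i];
   adj keeps it syntactically R[i], so that products with other matrices share
   one ring structure. *)
Definition adj (R : realType) m n (A : 'M[R[i]]_(m, n)) : 'M[R[i]]_(n, m) := A^t*.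
Notation "A ^H" := (adj A) (at level 8, format "A ^H") : ring_scope.

Section HermitianForms.
Context {R : realType}.
Local Notation C := R[i].

Definition sqmod (z : C) : R := complex.Re z ^+ 2 + complex.Im z ^+ 2.

Lemma sqmodE z : (sqmod z)%:C = conjc z * z.
Proof. by case: z => a b; rewrite /sqmod; simpc; congr (_ +i* _); ring. Qed.

Lemma sqmod_ge0 z : 0 <= sqmod z.
Proof. by rewrite addr_ge0 ?sqr_ge0. Qed.

Lemma sqmod_eq0 z : (sqmod z == 0) = (z == 0).
Proof. by rewrite paddr_eq0 ?sqr_ge0 // !sqrf_eq0 eq_complex. Qed.

Lemma adjE m n (A : 'M[C]_(m, n)) i j : A^H i j = conjc (A j i).
Proof. by rewrite /adj !mxE. Qed.

Lemma adjK m n (A : 'M[C]_(m, n)) : A^H^H = A.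
Proof. exact: trmxCK. Qed.

Lemma adjM m n p (A : 'M[C]_(m, n)) (B : 'M[C]_(n, p)) : (A *m B)^H = B^H *m A^H.
Proof.
apply/matrixP => i j; rewrite adjE 2!mxE rmorph_sum; apply: eq_bigr => k _.
by rewrite !adjE mulrC rmorphM.
Qed.

Lemma adjD m n (A B : 'M[C]_(m, n)) : (A + B)^H = A^H + B^H.
Proof.
by apply/matrixP => i j; rewrite adjE mxE [RHS]mxE !adjE rmorphD.
Qed.

Lemma adjZ m n (a : R) (A : 'M[C]_(m, n)) : (a%:C *: A)^H = a%:C *: A^H.
Proof.
by apply/matrixP => i j; rewrite adjE mxE [RHS]mxE adjE rmorphM /= oppr0.
Qed.

Lemma adj0 m n : (0 : 'M[C]_(m, n))^H = 0.
Proof. by apply/matrixP => i j; rewrite adjE !mxE rmorph0. Qed.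

Lemma adj1 n : (1%:M : 'M[C]_n)^H = 1%:M.
Proof. by apply/matrixP => i j; rewrite adjE !mxE rmorph_nat eq_sym. Qed.

Lemma adj_col_mx m1 m2 n (A : 'M[C]_(m1, n)) (B : 'M[C]_(m2, n)) :
  (col_mx A B)^H = row_mx A^H B^H.
Proof. by rewrite /adj tr_col_mx map_row_mx. Qed.

Lemma adj_perm n (p : 'S_n) : (perm_mx p : 'M[C]_n)^H = perm_mx (p^-1)%g.
Proof. by rewrite /adj tr_perm_mx map_perm_mx. Qed.

Lemma unitaryP m n (U : 'M[C]_(m, n)) : reflect (U *m U^H = 1%:M) (U \is unitarymx).
Proof. exact: unitarymxP. Qed.

Lemma unitaryM m n p (U : 'M[C]_(m, n)) (V : 'M[C]_(n, p)) :
  U \is unitarymx -> V \is unitarymx -> U *m V \is unitarymx.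
Proof.
move=> /unitaryP Uu /unitaryP Vu; apply/unitaryP.
by rewrite adjM mulmxA -(mulmxA U) Vu mulmx1.
Qed.

Lemma unitary_adj n (U : 'M[C]_n) : U \is unitarymx -> U^H \is unitarymx.
Proof. by move=> Uu; rewrite /adj trmxC_unitary. Qed.

Lemma unitary1 n : (1%:M : 'M[C]_n) \is unitarymx.
Proof. by apply/unitaryP; rewrite adj1 mulmx1. Qed.

Lemma unitary_perm n (p : 'S_n) : (perm_mx p : 'M[C]_n) \is unitarymx.
Proof. by apply/unitaryP; rewrite adj_perm -perm_mxM mulgV perm_mx1. Qed.

Lemma unitary_adjK n (U : 'M[C]_n) : U \is unitarymx -> U^H *m U = 1%:M.
Proof. by move=> /unitary_adj/unitaryP; rewrite adjK. Qed.

Lemma invmx_adj n (U : 'M[C]_n) : U \is unitarymx -> invmx U = U^H.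
Proof. exact: invmx_unitary. Qed.

Lemma hermsymmxP d (A : 'M[C]_d) : reflect (A^H = A) (A \is hermsymmx).
Proof. by apply: (iffP (is_hermitianmxP _ _ _)); rewrite expr0 scale1r => /esym. Qed.

Lemma psdmxP d (A : 'M[C]_d) :
  psdmx A <-> A^H = A /\ forall v : 'cV[C]_d, 0 <= (v^H *m A *m v) 0 0.
Proof. by split=> -[/hermsymmxP hA pA]; split. Qed.

Definition rdiag m (a : 'I_m -> R) : 'M[C]_m := diag_mx (\row_j (a j)%:C).

Lemma rdiag_adj m (a : 'I_m -> R) : (rdiag a)^H = rdiag a.
Proof.
apply/matrixP => i j; rewrite adjE !mxE rmorphMn /= oppr0 eq_sym.
by case: eqP => [->|].
Qed.

(** For unitary [U] this is a spectral decomposition whose eigenvectors are the columns of [U^H].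
    Rectangular [U] is allowed, so that matrices carried by a subspace and congruences keep the same
    form. *)
Definition herm m d (U : 'M[C]_(m, d)) (a : 'I_m -> R) : 'M[C]_d :=
  U^H *m rdiag a *m U.

Lemma herm_adj m d (U : 'M[C]_(m, d)) a : (herm U a)^H = herm U a.
Proof. by rewrite /herm !adjM rdiag_adj adjK mulmxA. Qed.

Lemma herm_is_hermsymmx m d (U : 'M[C]_(m, d)) a : herm U a \is hermsymmx.
Proof. by apply/hermsymmxP; rewrite herm_adj. Qed.

Lemma herm1 m (a : 'I_m -> R) : herm 1%:M a = rdiag a.
Proof. by rewrite /herm adj1 mul1mx mulmx1. Qed.

Lemma herm_congr m d p (U : 'M[C]_(m, d)) a (V : 'M[C]_(d, p)) :
  V^H *m herm U a *m V = herm (U *m V) a.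
Proof. by rewrite /herm adjM !mulmxA. Qed.

Lemma hermE m d (U : 'M[C]_(m, d)) a i j :
  herm U a i j = \sum_k conjc (U k i) * (a k)%:C * U k j.
Proof.
rewrite /herm /rdiag mul_mx_diag mxE; apply: eq_bigr => k _.
by rewrite mxE adjE mxE.
Qed.

Lemma herm_sub m d (U : 'M[C]_(m, d)) a b :
  herm U a - herm U b = herm U (fun i => a i - b i).
Proof.
apply/matrixP => i j.
have -> : (herm U a - herm U b) i j = herm U a i j - herm U b i j.
  by move: (herm U a) (herm U b) => A B; rewrite !mxE.
rewrite (hermE U a) (hermE U b) hermE -sumrB.
by apply: eq_bigr => k _; rewrite rmorphB mulrBr mulrBl.
Qed.

(** For Hermitian [A] the form is real, so taking the real part only moves its value to [R]. *)
Definition qform d (A : 'M[C]_d) (v : 'cV[C]_d) : R := complex.Re ((v^H *m A *m v) 0 0).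

Definition sqnorm d (v : 'cV[C]_d) : R := \sum_i sqmod (v i 0).

Lemma sqnormE d (v : 'cV[C]_d) : (sqnorm v)%:C = (v^H *m v) 0 0.
Proof. by rewrite mxE rmorph_sum; apply: eq_bigr => i _; rewrite /= sqmodE adjE. Qed.

Lemma sqnorm_ge0 d (v : 'cV[C]_d) : 0 <= sqnorm v.
Proof. by apply: sumr_ge0 => i _; exact: sqmod_ge0. Qed.

Lemma sqnorm_gt0 d (v : 'cV[C]_d) : v != 0 -> 0 < sqnorm v.
Proof.
move=> v0; rewrite lt_def sqnorm_ge0 andbT; apply: contraNneq v0 => /eqP.
rewrite psumr_eq0; last by move=> i _; exact: sqmod_ge0.
move=> /allP vz; apply/eqP/colP => i; rewrite mxE; apply/eqP.
by rewrite -sqmod_eq0 (eqP (implyP (vz i (mem_index_enum i)) isT)).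
Qed.

Lemma sqnorm_isometry m d (U : 'M[C]_(m, d)) v :
  U^H *m U = 1%:M -> sqnorm (U *m v) = sqnorm v.
Proof.
move=> UU; apply: complexI; rewrite !sqnormE adjM mulmxA -[_ *m U]mulmxA UU.
by rewrite mulmx1.
Qed.

Lemma herm_formE m d (U : 'M[C]_(m, d)) a (v : 'cV[C]_d) :
  (v^H *m herm U a *m v) 0 0 = (\sum_i sqmod ((U *m v) i 0) * a i)%:C.
Proof.
rewrite herm_congr /herm mxE rmorph_sum; apply: eq_bigr => i _.
rewrite /rdiag mul_mx_diag; move: (U *m v) => w.
by rewrite mxE adjE mxE rmorphM /= sqmodE mulrAC.
Qed.

Lemma qform_herm m d (U : 'M[C]_(m, d)) a (v : 'cV[C]_d) :
  qform (herm U a) v = \sum_i sqmod ((U *m v) i 0) * a i.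
Proof. by rewrite /qform herm_formE. Qed.

Lemma qform_congr d p (A : 'M[C]_d) (V : 'M[C]_(d, p)) v :
  qform (V^H *m A *m V) v = qform A (V *m v).
Proof. by rewrite /qform adjM !mulmxA. Qed.

Lemma qformD d (A B : 'M[C]_d) v : qform (A + B) v = qform A v + qform B v.
Proof. by rewrite /qform mulmxDr mulmxDl mxE raddfD. Qed.

Lemma qformZ d (a : R) (A : 'M[C]_d) v : qform (a%:C *: A) v = a * qform A v.
Proof.
rewrite /qform -scalemxAr -scalemxAl mxE.
by case: ((_ *m _) _ _) => x y /=; rewrite mul0r subr0.
Qed.

Lemma qform_sum d (T : finType) (a : T -> R) (A : T -> 'M[C]_d) v :
  qform (\sum_t (a t)%:C *: A t) v = \sum_t a t * qform (A t) v.
Proof.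
rewrite (big_morph (fun B => qform B v) (fun A B => qformD A B v) (id1 := 0)).
  by apply: eq_bigr => t _; rewrite qformZ.
by rewrite /qform mulmx0 mul0mx mxE.
Qed.

Lemma qformN d (A : 'M[C]_d) v : qform (- A) v = - qform A v.
Proof. by rewrite /qform mulmxN mulNmx mxE raddfN. Qed.

Lemma qform_ge0 d (A : 'M[C]_d) v : psdmx A -> 0 <= qform A v.
Proof. by move=> /psdmxP[_ /(_ v)]; rewrite /qform lecE => /andP[]. Qed.

Lemma psdmx_herm m d (U : 'M[C]_(m, d)) a : (forall i, 0 <= a i) -> psdmx (herm U a).
Proof.
move=> a0; apply/psdmxP; split; first exact: herm_adj.
by move=> v; rewrite herm_formE ler0c sumr_ge0 // => i _; rewrite mulr_ge0 ?sqmod_ge0.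
Qed.

Lemma psdmx0 d : psdmx (0 : 'M[C]_d).
Proof.
apply/psdmxP; split; first exact: adj0.
by move=> v; rewrite mulmx0 mul0mx mxE.
Qed.

Lemma psdmxD d (A B : 'M[C]_d) : psdmx A -> psdmx B -> psdmx (A + B).
Proof.
move=> /psdmxP[hA pA] /psdmxP[hB pB]; apply/psdmxP; split.
  by rewrite adjD hA hB.
by move=> v; rewrite mulmxDr mulmxDl mxE addr_ge0.
Qed.

Lemma psdmxZ d (a : R) (A : 'M[C]_d) : 0 <= a -> psdmx A -> psdmx (a%:C *: A).
Proof.
move=> a0 /psdmxP[hA pA]; apply/psdmxP; split; first by rewrite adjZ hA.
by move=> v; rewrite -scalemxAr -scalemxAl mxE mulr_ge0 // ler0c.
Qed.

Lemma psdmx_sum d (T : finType) (a : T -> R) (A : T -> 'M[C]_d) :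
  (forall t, 0 <= a t) -> (forall t, psdmx (A t)) -> psdmx (\sum_t (a t)%:C *: A t).
Proof.
move=> a0 pA; apply: (big_ind (@psdmx R d)); [exact: psdmx0|exact: psdmxD|].
by move=> t _; apply: psdmxZ.
Qed.

Lemma psdmx_congr d p (A : 'M[C]_d) (V : 'M[C]_(d, p)) :
  psdmx A -> psdmx (V^H *m A *m V).
Proof.
move=> /psdmxP[hA pA]; apply/psdmxP; split; first by rewrite !adjM hA adjK mulmxA.
by move=> v; have := pA (V *m v); rewrite adjM !mulmxA.
Qed.

Lemma loewner_le_trans d (B A D : 'M[C]_d) :
  loewner_le A B -> loewner_le B D -> loewner_le A D.
Proof. by move=> AB BD; have := psdmxD BD AB; rewrite addrA subrK. Qed.

Lemma loewner_leD d (A B A' B' : 'M[C]_d) :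
  loewner_le A B -> loewner_le A' B' -> loewner_le (A + A') (B + B').
Proof.
by move=> AB AB'; have := psdmxD AB AB'; rewrite addrACA -opprD.
Qed.

Lemma loewner_le_congr d p (A B : 'M[C]_d) (V : 'M[C]_(d, p)) :
  loewner_le A B -> loewner_le (V^H *m A *m V) (V^H *m B *m V).
Proof. by move=> /(psdmx_congr V); rewrite mulmxBr mulmxBl. Qed.

Lemma loewner_le_sum d (T : finType) (a : T -> R) (A B : T -> 'M[C]_d) :
  (forall t, 0 <= a t) -> (forall t, loewner_le (A t) (B t)) ->
  loewner_le (\sum_t (a t)%:C *: A t) (\sum_t (a t)%:C *: B t).
Proof.
move=> a0 AB; have := psdmx_sum a0 AB; rewrite /loewner_le -sumrB.
by under eq_bigr do rewrite scalerBr.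
Qed.

Lemma loewner_le_qform d (A B : 'M[C]_d) v : loewner_le A B -> qform A v <= qform B v.
Proof. by move=> /(qform_ge0 v); rewrite qformD qformN subr_ge0. Qed.

Lemma mxfunE d (f : R -> R) (A : 'M[C]_d) :
  mxfun f A = herm (spectralmx A) (fun j => f (complex.Re (spectral_diag A 0 j))).
Proof. by rewrite /mxfun (invmx_adj (spectral_unitarymx A)). Qed.

Lemma spectral_herm d (A : 'M[C]_d) : A \is hermsymmx ->
  A = herm (spectralmx A) (fun j => complex.Re (spectral_diag A 0 j)).
Proof.
move=> hA.
have {1}-> : A = invmx (spectralmx A) *m diag_mx (spectral_diag A) *m spectralmx A.
  exact/orthomx_spectralP/hermitian_normalmx.
rewrite (invmx_adj (spectral_unitarymx A)).
have {1}-> // : diag_mx (spectral_diag A)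
  = rdiag (fun j => complex.Re (spectral_diag A 0 j)) :> 'M[C]_d.
congr diag_mx; apply/rowP => j; rewrite mxE RRe_real //.
exact: (mxOverP (hermitian_spectral_diag_real hA)).
Qed.

(** Testing the form on the [i]-th column of [U^H] isolates [a i]. *)
Lemma herm_ge0 d (U : 'M[C]_d) a : U \is unitarymx -> psdmx (herm U a) ->
  forall i, 0 <= a i.
Proof.
move=> Uu /qform_ge0 p i.
have := p (U^H *m delta_mx i 0); rewrite qform_herm mulmxA (unitaryP _ Uu) mul1mx.
rewrite (bigD1 i) //= big1 => [|j ji]; rewrite !mxE eqxx.
  by rewrite addr0 eqxx /sqmod /= expr0n expr1n addr0 mul1r.
by rewrite (negPf ji) /sqmod /= expr0n add0r mul0r.
Qed.

End HermitianForms.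

(** * Comparison of spectra by counting *)

(** Dimension count: if [P] were smaller than [Q], then requiring the coordinates of [T *m x] in [P]
    to vanish would be fewer equations than the unknowns of an [x] supported on [Q], and some
    nonzero [x] would escape detection. This takes the place of the min-max principle. *)
Lemma card_le_of_detect (F : fieldType) k m (T : 'M[F]_(k, m))
    (Q : pred 'I_m) (P : pred 'I_k) :
  (forall x : 'cV[F]_m, x != 0 -> (forall j, ~~ Q j -> x j 0 = 0) ->
     exists2 i, P i & (T *m x) i 0 != 0) ->
  (#|Q| <= #|P|)%N.
Proof.
move=> det; rewrite leqNgt; apply/negP => ltPQ.
(* [D] embeds the vectors supported on [Q], and [E] keeps the coordinates in [P]. The transpose of
   [T] appears below because [kermx] is a left kernel. *)
pose D : 'M[F]_(#|Q|, m) := rowsub enum_val 1%:M.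
pose E : 'M[F]_(k, #|P|) := colsub enum_val 1%:M.
have /rowV0Pn[u uker u0] : kermx (D *m T^T *m E) != 0.
  by rewrite -mxrank_eq0 mxrank_ker -lt0n subn_gt0 (leq_ltn_trans (rank_leq_col _)).
have DE q j : D q j = (enum_val q == j)%:R by rewrite !mxE.
have uDE (q : 'I_#|Q|) : (u *m D) 0 (enum_val q) = u 0 q.
  rewrite mxE (bigD1 q) //= big1 ?addr0 ?DE ?eqxx ?mulr1 // => p pq.
  by rewrite DE (inj_eq enum_val_inj) (negPf pq) mulr0.
have [||i Pi] := det (u *m D)^T.
- apply: contraNneq u0 => /(congr1 trmx); rewrite trmxK trmx0 => uD0.
  by apply/eqP/rowP => q; rewrite -uDE uD0 !mxE.
- move=> j nQj; rewrite mxE mxE big1 // => q _; rewrite DE.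
  by case: eqP => [ej|]; rewrite ?mulr0 //; case/negP: nQj; rewrite -ej; exact: enum_valP.
case/eqP; rewrite -[T]trmxK -trmx_mul mxE.
move: uker => /sub_kermxP/rowP/(_ (enum_rank_in Pi i)); rewrite !mulmxA mxE [RHS]mxE => <-.
rewrite (bigD1 i) //= big1 ?addr0.
  by rewrite !mxE enum_rankK_in // eqxx mulr1.
by move=> j ji; rewrite !mxE enum_rankK_in // (negPf ji) mulr0.
Qed.

Lemma sort_perm (R : realType) m (a : 'I_m -> R) : exists s : 'S_m,
  (forall j k : 'I_m, (j <= k)%N -> a (s k) <= a (s j)) /\
  forall k : 'I_m, a (s k) = nth 0 (sort >=%R [seq a j | j <- enum 'I_m]) k.
Proof.
have /tuple_permP[s es] : perm_eq (sort >=%R [seq a j | j <- enum 'I_m])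
   [tuple a j | j < m].
  by rewrite perm_sort.
have nthE k : a (s k) = nth 0 (sort >=%R [seq a j | j <- enum 'I_m]) k.
  rewrite es (nth_map k) ?size_enum_ord // nth_ord_enum.
  by rewrite tnth_mktuple.
exists s; split=> // j k jk; rewrite !nthE.
have so : sorted >=%R (sort >=%R [seq a j | j <- enum 'I_m]).
  by apply: sort_sorted => x y; exact: ge_total.
apply: (sorted_leq_nth _ _ _ so) => //.
- by move=> x y z /= xy yz; exact: le_trans yz xy.
- by move=> x /=.
- by rewrite inE size_sort size_map size_enum_ord.
- by rewrite inE size_sort size_map size_enum_ord.
Qed.

(** The permutation pairs the entries of [a] and [b] of equal rank in decreasing order. *)
Lemma dominated_perm (R : realType) m (a b : 'I_m -> R) :
  (forall s, (#|[pred j | (s < a j)%R]| <= #|[pred j | (s < b j)%R]|)%N) ->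
  exists p : 'S_m, forall j, a j <= b (p j).
Proof.
move=> cnt; have [s [sa _]] := sort_perm a; have [t [tb _]] := sort_perm b.
exists (s^-1 * t)%g => j; rewrite permM -{1}(permKV s j); move: (s^-1 _)%g => k.
rewrite leNgt; apply/negP => lt_k.
(* At the threshold [b (t k)], at least [k + 1] entries of [a] lie above and at most [k] entries of
   [b] do. *)
have := cnt (b (t k)); apply/negP; rewrite -ltnNge.
have le1 : (#|[pred j : 'I_m | (j <= k)%N]| <= #|[pred j | (b (t k) < a j)%R]|)%N.
  rewrite -(card_image (@perm_inj _ s)); apply: subset_leq_card.
  apply/fintype.subsetP => x /fintype.imageP[i ik ->{x}].
  by rewrite inE (lt_le_trans lt_k) // sa.
have le2 : (#|[pred j | (b (t k) < b j)%R]| <= #|[pred j : 'I_m | (j < k)%N]|)%N.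
  rewrite -(card_image (@perm_inj _ t) [pred j : 'I_m | (j < k)%N]).
  apply: subset_leq_card; apply/fintype.subsetP => i; rewrite inE -(permKV t i) => bi.
  rewrite fintype.image_f // inE ltnNge; apply: contraL bi => ki.
  by rewrite -leNgt tb.
apply: (leq_ltn_trans le2); apply: leq_trans le1.
apply: proper_card; apply/properP; split.
  by apply/fintype.subsetP => i; rewrite !inE => /ltnW.
by exists k; rewrite !inE ?ltnn.
Qed.

Section Dominance.
Context {R : realType}.
Local Notation C := R[i].

Lemma herm_perm m d (H : 'M[C]_(m, d)) (b : 'I_m -> R) (p : 'S_m) :
  herm ((perm_mx p)^H *m H) b = herm H (fun j => b (p j)).
Proof.
rewrite /herm adjM adjK -!mulmxA; congr (_ *m _); rewrite !mulmxA; congr (_ *m _).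
have -> : perm_mx p *m rdiag b = rdiag (fun j => b (p j)) *m perm_mx p.
  rewrite -row_permE /rdiag mul_diag_mx; apply/matrixP => i j; rewrite !mxE.
  by case: eqP => _; rewrite ?mulr1n ?mulr1 ?mulr0n ?mulr0.
rewrite -mulmxA (_ : perm_mx p *m _ = 1%:M) ?mulmx1 //.
by rewrite adj_perm -perm_mxM mulgV perm_mx1.
Qed.

(** The unitary carries one eigenbasis to the other, matched by [dominated_perm]; both matrices are
    then diagonal in one basis and compare entrywise. The sizes are linked by an equation because
    [H] will be a stack of two blocks. *)
Lemma herm_dominated m d (H : 'M[C]_(m, d)) (a : 'I_m -> R)
    (K : 'M[C]_d) (b : 'I_d -> R) :
  m = d -> H \is unitarymx -> K \is unitarymx ->
  (forall s, (#|[pred j | (s < a j)%R]| <= #|[pred j | (s < b j)%R]|)%N) ->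
  exists2 W : 'M[C]_d, W \is unitarymx & loewner_le (herm H a) (W *m herm K b *m W^H).
Proof.
move=> emd; case: d / emd H K b => H K b Hu Ku /dominated_perm[p ab].
exists (H^H *m perm_mx p *m K).
  apply: unitaryM Ku; apply: unitaryM (unitary_perm p); exact: unitary_adj.
rewrite -{1}[_ *m K]adjK herm_congr !adjM adjK !mulmxA (unitaryP _ Ku) mul1mx.
rewrite herm_perm /loewner_le herm_sub; apply: psdmx_herm => i.
by rewrite subr_ge0.
Qed.

End Dominance.

(** * Interlacing and Jensen's inequality for compressions *)

Section Compressions.
Context {R : realType}.
Local Notation C := R[i].

(** The two interval conditions make [P] an initial or a final segment of the half-line, so both
    directions of Cauchy interlacing are covered. A vector built from the [c j] in [P] has its
    Rayleigh quotient in [P]; if it had no component along the [a i] in [P], the same quotient would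
    be outside [P]. *)
Lemma interlacing_card m d (U : 'M[C]_d) (a : 'I_d -> R) (H : 'M[C]_(m, d))
    (c : 'I_m -> R) (P : pred R) :
  U \is unitarymx -> (forall i, 0 <= a i) ->
  H *m herm U a *m H^H = rdiag c ->
  H \is unitarymx ->
  interval_nneg P -> interval_nneg (fun x => ~~ P x) ->
  (#|[pred j | P (c j)]| <= #|[pred i | P (a i)]|)%N.
Proof.
move=> Uu a0 HX Hu IP IN.
have c0 : forall j, 0 <= c j.
  apply: (@herm_ge0 _ _ 1%:M); first exact: unitary1.
  rewrite herm1 -HX -{1}[H]adjK; exact/psdmx_congr/psdmx_herm.
apply: (@card_le_of_detect _ _ _ (U *m H^H)) => x x0 xP.
case: (pickP [pred i | P (a i) && ((U *m H^H *m x) i 0 != 0)]) => [i /andP[]|none].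
  by exists i.
have UHK : (U *m H^H)^H *m (U *m H^H) = 1%:M.
  by rewrite adjM adjK mulmxA -(mulmxA H) unitary_adjK // mulmx1 (unitaryP _ Hu).
(* [e1] and [e2] equate the denominators and the numerators of the Rayleigh quotient of [H^H *m x],
   computed in the basis [U] and in the frame [H]. *)
have e1 : \sum_i sqmod ((U *m H^H *m x) i 0) = \sum_j sqmod (x j 0).
  exact: (sqnorm_isometry x UHK).
have e2 : \sum_i sqmod ((U *m H^H *m x) i 0) * a i = \sum_j sqmod (x j 0) * c j.
  rewrite -mulmxA -qform_herm -qform_congr adjK HX -herm1 qform_herm.
  by under eq_bigr do rewrite mul1mx.
have N0 := sqnorm_gt0 x0.
have Pm : P (wmean (fun j => sqmod (x j 0)) c).
  apply: (@wmean_interval _ (fun y => P y)) => // [j|j xj]; first exact: sqmod_ge0.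
  by apply: contraNT xj => /xP ->; rewrite sqmod_eq0.
have : ~~ P (wmean (fun i => sqmod ((U *m H^H *m x) i 0)) a).
  apply: (@wmean_interval _ (fun x => ~~ P x)) => // [i||i].
  - exact: sqmod_ge0.
  - by rewrite e1.
  rewrite sqmod_eq0 => xi; have /negbT := none i.
  by rewrite /= xi andbT.
by rewrite /wmean e1 e2 Pm.
Qed.

(* For convex g, the interval hypothesis on superlevel sets (quasi-concavity)
   amounts to monotonicity; it treats both directions at once. *)
Lemma monotone_convex_mean m (n : nat) (alpha : 'I_n -> R) (g : R -> R)
    (A : 'I_n -> 'M[C]_m) (c : 'I_n -> 'I_m -> R) (nu : 'I_m -> R) :
  (forall t, 0 <= alpha t) -> \sum_t alpha t = 1 ->
  convex_nneg g -> (forall s, interval_nneg (fun x => s < g x)) ->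
  (forall t, A t \is unitarymx) -> (forall t i, 0 <= c t i) ->
  \sum_t (alpha t)%:C *: herm (A t) (c t) = rdiag nu ->
  exists2 W : 'M[C]_m, W \is unitarymx &
    loewner_le (rdiag (fun j => g (nu j)))
      (W *m (\sum_t (alpha t)%:C *: herm (A t) (fun i => g (c t i))) *m W^H).
Proof.
move=> a0 a1 gc gi Au c0 Enu.
have nu0 : forall j, 0 <= nu j.
  apply: (herm_ge0 (unitary1 m)); rewrite herm1 -Enu.
  by apply: psdmx_sum => // t; apply: psdmx_herm.
set F := \sum_t _.
have Fh : F \is hermsymmx.
  apply/hermsymmxP; rewrite /F (big_morph (@adj R m m) (@adjD _ _ _) (adj0 _ _)).
  by apply: eq_bigr => t _; rewrite adjZ herm_adj.
have Gu := spectral_unitarymx F; have EF := spectral_herm Fh.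
move: (spectralmx F) (fun j => _) Gu EF => G b Gu EF.
rewrite -herm1 EF; apply: (herm_dominated (erefl m) (unitary1 m) Gu) => s.
(* Here [x] is supported where [s < g (nu j)]. If it had no component on eigenvectors of [F] with
   eigenvalue above [s], its Rayleigh quotient for [F] would be at most [s], which the bounds below
   refute. *)
apply: (@card_le_of_detect _ _ _ G) => x x0 xP.
case: (pickP [pred i | (s < b i) && ((G *m x) i 0 != 0)]) => [i /andP[]|none].
  by exists i.
have N0 := sqnorm_gt0 x0.
have upper : qform F x <= s * sqnorm x.
  rewrite EF qform_herm -(sqnorm_isometry x (unitary_adjK Gu)) mulr_sumr.
  apply: ler_sum => i _; have /negbT := none i.
  rewrite /= negb_and negbK -leNgt => /orP[bi|/eqP->].
    by rewrite mulrC ler_wpM2r ?sqmod_ge0.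
  by rewrite /sqmod /= expr0n addr0 mul0r mulr0.
pose mean t := wmean (fun i => sqmod ((A t *m x) i 0)) (c t).
have An t : \sum_i sqmod ((A t *m x) i 0) = sqnorm x.
  exact: (sqnorm_isometry x (unitary_adjK (Au t))).
have mean0 t : 0 <= mean t by apply: wmean_ge0 => // i; exact: sqmod_ge0.
have meanE : \sum_t alpha t * mean t = wmean (fun j => sqmod (x j 0)) nu.
  have -> : wmean (fun j => sqmod (x j 0)) nu = qform (rdiag nu) x / sqnorm x.
    rewrite -herm1 qform_herm /wmean.
    by under [in RHS]eq_bigr do rewrite mul1mx.
  rewrite -Enu qform_sum mulr_suml; apply: eq_bigr => t _.
  by rewrite qform_herm /mean /wmean An mulrA.
(* Jensen is used twice: for the weights [alpha], then for each [t] with the squared coordinates of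
   [x] in the eigenbasis [A t]. *)
have lower : g (\sum_t alpha t * mean t) * sqnorm x <= qform F x.
  have a1p : 0 < \sum_t alpha t by rewrite a1.
  have := jensen gc a0 mean0 a1p; rewrite /wmean a1 divr1 mulr1 => J.
  apply: (le_trans (ler_wpM2r (ltW N0) J)).
  rewrite /F qform_sum mulr_suml; apply: ler_sum => t _.
  rewrite -mulrA ler_wpM2l // qform_herm -(An t); apply: jensen => //.
    by move=> i; exact: sqmod_ge0.
  by rewrite An.
have : s < g (\sum_t alpha t * mean t).
  rewrite meanE; apply: (@wmean_interval _ (fun x => s < g x)) => // [j|j xj].
    exact: sqmod_ge0.
  by apply: contraNT xj => /xP ->; rewrite sqmod_eq0.
rewrite -(ltr_pM2r N0) => /lt_le_trans /(_ lower) /lt_le_trans /(_ upper).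
by rewrite ltxx.
Qed.

End Compressions.

(** * Monotone envelopes and block decompositions *)

Section Convexity.
Context {R : realType}.
Variable f : R -> R.
Hypotheses (f_ge0 : forall x : R, 0 <= x -> 0 <= f x) (f_cvx : convex_nneg f).

Definition upper_envelope := envelope f (fun x y => x <= y).
Definition lower_envelope := envelope f (fun x y => y <= x).

Lemma upper_envelope_convex : convex_nneg upper_envelope.
Proof.
apply: envelope_convex => // x1 x2 y1 y2 t t0 t1 xy1 xy2.
by rewrite lerD // ler_wpM2l // subr_ge0.
Qed.

Lemma lower_envelope_convex : convex_nneg lower_envelope.
Proof.
apply: envelope_convex => // x1 x2 y1 y2 t t0 t1 xy1 xy2.
by rewrite lerD // ler_wpM2l // subr_ge0.
Qed.

Lemma upper_envelope_le x : 0 <= x -> upper_envelope x <= f x.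
Proof. by move=> x0; apply: envelope_le. Qed.

Lemma lower_envelope_le x : 0 <= x -> lower_envelope x <= f x.
Proof. by move=> x0; apply: envelope_le. Qed.

Lemma upper_envelope_interval s : interval_nneg (fun x => s < upper_envelope x).
Proof.
move=> x y z x0 xy yz sx _; apply: (lt_le_trans sx).
have y0 := le_trans x0 xy.
by apply: envelope_ge => // w w0 yw; apply: envelope_le => //; exact: le_trans yw.
Qed.

Lemma lower_envelope_interval s : interval_nneg (fun x => s < lower_envelope x).
Proof.
move=> x y z x0 xy yz _ sz; apply: (lt_le_trans sz).
have y0 := le_trans x0 xy; have z0 := le_trans y0 yz.
by apply: envelope_ge => // w w0 yw; apply: envelope_le => //; exact: le_trans yz.
Qed.

Lemma upper_envelope_eq x : 0 <= x ->
  (forall y z, x <= y -> y <= z -> f y <= f z) -> upper_envelope x = f x.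
Proof.
move=> x0 inc; apply/le_anti; rewrite upper_envelope_le //=.
by apply: envelope_ge => // y y0 xy; exact: inc.
Qed.

Lemma lower_envelope_eq x : 0 <= x ->
  (forall y z, 0 <= y -> y <= z -> z <= x -> f z <= f y) -> lower_envelope x = f x.
Proof.
move=> x0 dec; apply/le_anti; rewrite lower_envelope_le //=.
by apply: envelope_ge => // y y0 xy; exact: dec.
Qed.

(** The upper envelope at [x] bounds [f] from below to the right of [x], the lower envelope to the
    left. *)
Lemma envelope_superlevel x s y : 0 <= x -> s < upper_envelope x ->
  s < lower_envelope x -> 0 <= y -> s < f y.
Proof.
move=> x0 su sl y0; have [xy|/ltW yx] := leP x y.
  by apply: (lt_le_trans su); exact: envelope_le.
by apply: (lt_le_trans sl); exact: envelope_le.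
Qed.

(** If both envelopes exceed [s] at a common [a i], then [f] exceeds [s] everywhere and [p + q <= m]
    suffices. Otherwise the two index sets are disjoint, and both lie in the superlevel set of
    [f]. *)
Lemma envelope_card m p q (a : 'I_m -> R) (b : 'I_p -> R) (c : 'I_q -> R) s :
  (forall i, 0 <= a i) -> (p + q <= m)%N ->
  (#|[pred j | (s < b j)%R]| <= #|[pred i | (s < upper_envelope (a i))%R]|)%N ->
  (#|[pred j | (s < c j)%R]| <= #|[pred i | (s < lower_envelope (a i))%R]|)%N ->
  (#|[pred j | (s < b j)%R]| + #|[pred j | (s < c j)%R]|
     <= #|[pred i | (s < f (a i))%R]|)%N.
Proof.
move=> a0 pqm lb lc.
case: (pickP [pred i | (s < upper_envelope (a i)) && (s < lower_envelope (a i))]).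
  move=> i /andP[su sl]; rewrite [X in (_ <= X)%N]eq_cardT ?size_enum_ord; last first.
    by move=> j; rewrite !inE; exact: (envelope_superlevel (a0 i)).
  apply: leq_trans pqm; apply: leq_add.
    by rewrite -[X in (_ <= X)%N]card_ord; exact: max_card.
  by rewrite -[X in (_ <= X)%N]card_ord; exact: max_card.
move=> none; apply: (leq_trans (leq_add lb lc)).
rewrite -cardUI [X in (_ + X)%N]eq_card0 ?addn0; last first.
  by move=> i; have := none i; rewrite !inE.
apply: subset_leq_card; apply/fintype.subsetP => i; rewrite !inE => /orP[] si.
  exact: lt_le_trans (upper_envelope_le (a0 i)).
exact: lt_le_trans (lower_envelope_le (a0 i)).
Qed.

End Convexity.

Section Blocks.
Context {R : realType}.
Local Notation C := R[i].

Definition block_fun p q (a : 'I_p -> R) (b : 'I_q -> R) (k : 'I_(p + q)) : R :=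
  match split k with inl i => a i | inr j => b j end.

Lemma herm_col_mx p q d (A : 'M[C]_(p, d)) (B : 'M[C]_(q, d)) a b :
  herm (col_mx A B) (block_fun a b) = herm A a + herm B b.
Proof.
apply/matrixP => i j; rewrite [RHS]mxE !hermE big_split_ord /=; congr (_ + _).
  apply: eq_bigr => k _; rewrite !col_mxEu /block_fun.
  by rewrite (unsplitK (inl k : 'I_p + 'I_q)).
apply: eq_bigr => k _; rewrite !col_mxEd /block_fun.
by rewrite (unsplitK (inr k : 'I_p + 'I_q)).
Qed.

Lemma block_fun_card p q (a : 'I_p -> R) (b : 'I_q -> R) s :
  #|[pred k | (s < block_fun a b k)%R]|
    = (#|[pred j | (s < a j)%R]| + #|[pred j | (s < b j)%R]|)%N.
Proof.
rewrite -!sum1_card big_mkcond big_split_ord /=; congr (_ + _)%N.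
  rewrite [RHS]big_mkcond; apply: eq_bigr => k _; rewrite !inE /block_fun.
  by rewrite (unsplitK (inl k : 'I_p + 'I_q)).
rewrite [RHS]big_mkcond; apply: eq_bigr => k _; rewrite !inE /block_fun.
by rewrite (unsplitK (inr k : 'I_p + 'I_q)).
Qed.

Lemma col_mx_unitary p q d (A : 'M[C]_(p, d)) (B : 'M[C]_(q, d)) :
  A \is unitarymx -> B \is unitarymx -> A *m B^H = 0 -> col_mx A B \is unitarymx.
Proof.
move=> /unitaryP Au /unitaryP Bu AB; apply/unitaryP.
have BA : B *m A^H = 0 by rewrite -[B]adjK -adjM AB adj0.
by rewrite adj_col_mx mul_col_row Au Bu AB BA -scalar_mx_block.
Qed.

Lemma rowsub_mul_adj m p q d (U : 'M[C]_(m, d)) (h : 'I_p -> 'I_m) (k : 'I_q -> 'I_m) i j :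
  U \is unitarymx -> (rowsub h U *m (rowsub k U)^H) i j = (h i == k j)%:R.
Proof.
move=> /unitaryP/matrixP/(_ (h i) (k j)); rewrite [in RHS]mxE => <-.
by rewrite !mxE; apply: eq_bigr => l _; rewrite !mxE.
Qed.

Lemma rowsub_unitary m p d (U : 'M[C]_(m, d)) (h : 'I_p -> 'I_m) :
  U \is unitarymx -> injective h -> rowsub h U \is unitarymx.
Proof.
move=> Uu hi; apply/unitaryP/matrixP => i j.
by rewrite rowsub_mul_adj // (inj_eq hi) mxE.
Qed.

Lemma rowsub_compress m p d (U : 'M[C]_(m, d)) a (h : 'I_p -> 'I_m) :
  U \is unitarymx -> injective h ->
  rowsub h U *m herm U a *m (rowsub h U)^H = rdiag (fun j => a (h j)).
Proof.
move=> Uu hi; rewrite -{1}[rowsub h U]adjK herm_congr.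
apply/matrixP => i j; rewrite hermE /rdiag [RHS]mxE [in RHS]mxE.
have UE k l : (U *m (rowsub h U)^H) k l = (k == h l)%:R.
  by rewrite -(rowsub_mul_adj id h k l Uu) mxsub_id.
rewrite (bigD1 (h i)) //= big1 => [|k khi]; rewrite !UE.
  by rewrite eqxx (inj_eq hi) addr0 rmorph_nat mul1r; case: eqP => _; rewrite ?mulr1 ?mulr0.
by rewrite (negPf khi) rmorph_nat !mul0r.
Qed.

Lemma herm_partition d (A : pred 'I_d) (U : 'M[C]_d) a :
  herm U a = herm (rowsub (fun k : 'I_#|A| => enum_val k) U) (fun k => a (enum_val k))
    + herm (rowsub (fun k : 'I_#|[predC A]| => enum_val k) U) (fun k => a (enum_val k)).
Proof.
apply/matrixP => i j; rewrite [RHS]mxE !hermE (bigID A) /=; congr (_ + _).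
  by rewrite big_enum_val; apply: eq_bigr => k _; rewrite !mxE.
rewrite (eq_bigl (fun k => k \in [predC A])) // big_enum_val.
by apply: eq_bigr => k _; rewrite !mxE.
Qed.

End Blocks.

(** * The bound by unitary orbits, in one block and then in both *)

Section UnitaryOrbits.
Context {R : realType}.
Local Notation C := R[i].

(** The contribution of one block: each matrix is compressed to the frame [V] and diagonalised
    there, the mean inequality is applied in size [m], and the result is carried back by [V].
    Interlacing gives the eigenvalue counts. *)
Lemma compression_bound m d (n : nat) (V : 'M[C]_(m, d)) (alpha : 'I_n -> R)
    (U : 'I_n -> 'M[C]_d) (a : 'I_n -> 'I_d -> R) (nu : 'I_m -> R) (g : R -> R) :
  V \is unitarymx -> (forall t, 0 <= alpha t) -> \sum_t alpha t = 1 ->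
  (forall t, U t \is unitarymx) -> (forall t i, 0 <= a t i) ->
  V *m (\sum_t (alpha t)%:C *: herm (U t) (a t)) *m V^H = rdiag nu ->
  convex_nneg g -> (forall s, interval_nneg (fun x => s < g x)) ->
  exists (S : 'I_n -> 'M[C]_m) (b : 'I_n -> 'I_m -> R),
    [/\ forall t, S t \is unitarymx,
        loewner_le (herm V (fun j => g (nu j))) (\sum_t (alpha t)%:C *: herm (S t *m V) (b t)) &
        forall t s, (#|[pred j | (s < b t j)%R]| <= #|[pred i | (s < g (a t i))%R]|)%N].
Proof.
move=> Vu al0 al1 Uu a0 EV gc gi.
pose Y t := V *m herm (U t) (a t) *m V^H.
have Yp t : psdmx (Y t) by rewrite /Y -{1}[V]adjK; exact/psdmx_congr/psdmx_herm.
have [A [c [Au EY]]] : exists (A : 'I_n -> 'M[C]_m) (c : 'I_n -> 'I_m -> R),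
    (forall t, A t \is unitarymx) /\ forall t, Y t = herm (A t) (c t).
  exists (fun t => spectralmx (Y t)), (fun t j => complex.Re (spectral_diag (Y t) 0 j)).
  split=> t; first exact: spectral_unitarymx.
  by apply: spectral_herm; case: (Yp t).
have c0 t i : 0 <= c t i by apply: (herm_ge0 (Au t)); rewrite -EY.
have EN : \sum_t (alpha t)%:C *: herm (A t) (c t) = rdiag nu.
  rewrite -EV mulmx_sumr mulmx_suml; apply: eq_bigr => t _.
  by rewrite -EY -scalemxAr -scalemxAl.
have [W Wu le] := monotone_convex_mean al0 al1 gc gi Au c0 EN.
(* The unitary [W] of the mean inequality is absorbed into the eigenframes. *)
exists (fun t => A t *m W^H), (fun t j => g (c t j)); split.
- by move=> t; exact: unitaryM (Au t) (unitary_adj Wu).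
- have := loewner_le_congr V le; rewrite -[rdiag _]herm1 herm_congr mul1mx.
  rewrite -{1}[W]adjK mulmx_sumr mulmx_suml mulmx_sumr mulmx_suml.
  congr loewner_le; apply: eq_bigr => t _.
  by rewrite -!scalemxAr -!scalemxAl -scalemxAr -scalemxAl !herm_congr.
move=> t s.
apply: (@interlacing_card _ _ _ (U t) (a t) (A t *m V) _ (fun x => s < g x) (Uu t) (a0 t)).
- have -> : A t *m V *m herm (U t) (a t) *m (A t *m V)^H = A t *m Y t *m (A t)^H.
    by rewrite /Y adjM !mulmxA.
  rewrite EY /herm !mulmxA (unitaryP _ (Au t)) mul1mx -mulmxA.
  by rewrite (unitaryP _ (Au t)) mulmx1.
- exact: unitaryM (Au t) Vu.
- exact: gi.
(* The complement of a superlevel set is a sublevel set of a convex function, hence an interval. *)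
move=> x y z x0 xy yz; rewrite -!leNgt.
exact: (convex_nneg_interval_le gc).
Qed.

Lemma unitary_orbit_bound d (n : nat) (alpha : 'I_n -> R) (f : R -> R)
    (U : 'I_n -> 'M[C]_d) (a : 'I_n -> 'I_d -> R) (Q : 'M[C]_d) (mu : 'I_d -> R) :
  (forall t, 0 <= alpha t) -> \sum_t alpha t = 1 ->
  (forall x : R, 0 <= x -> 0 <= f x) -> convex_nneg f ->
  (forall t, U t \is unitarymx) -> (forall t i, 0 <= a t i) -> Q \is unitarymx ->
  \sum_t (alpha t)%:C *: herm (U t) (a t) = herm Q mu ->
  exists2 W : 'I_n -> 'M[C]_d, (forall t, W t \is unitarymx) &
    loewner_le (herm Q (fun j => f (mu j)))
      (\sum_t (alpha t)%:C *: (W t *m herm (U t) (fun i => f (a t i)) *m (W t)^H)).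
Proof.
move=> al0 al1 f0 fc Uu a0 Qu EM.
have mu0 : forall j, 0 <= mu j.
  apply: (herm_ge0 Qu); rewrite -EM.
  by apply: psdmx_sum => // t; apply: psdmx_herm.
pose up : pred 'I_d := fun j => `[< forall y z, mu j <= y -> y <= z -> f y <= f z >].
pose kp (k : 'I_#|up|) := enum_val k; pose km (k : 'I_#|[predC up]|) := enum_val k.
have kpi : injective kp by exact: enum_val_inj.
have kmi : injective km by exact: enum_val_inj.
pose Vp := rowsub kp Q; pose Vm := rowsub km Q.
have Vpu : Vp \is unitarymx by exact: rowsub_unitary.
have Vmu : Vm \is unitarymx by exact: rowsub_unitary.
have [Sp [bp [Spu lep cntp]]] := compression_bound Vpu al0 al1 Uu a0
  (etrans (congr1 (fun Z => Vp *m Z *m Vp^H) EM) (rowsub_compress mu Qu kpi))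
  (upper_envelope_convex f0 fc) (upper_envelope_interval f0).
have [Sm [bm [Smu lem cntm]]] := compression_bound Vmu al0 al1 Uu a0
  (etrans (congr1 (fun Z => Vm *m Z *m Vm^H) EM) (rowsub_compress mu Qu kmi))
  (lower_envelope_convex f0 fc) (lower_envelope_interval f0).
have epq : (#|up| + #|[predC up]| = d)%N by rewrite cardC card_ord.
have VpVm : Vp *m Vm^H = 0.
  apply/matrixP => i j; rewrite rowsub_mul_adj // mxE; case: eqP => // e.
  have := enum_valP j; rewrite -[enum_val j]/(km j) -e inE.
  by rewrite [_ \in _](enum_valP i).
pose H t := col_mx (Sp t *m Vp) (Sm t *m Vm).
have Hu t : H t \is unitarymx.
  apply: col_mx_unitary; [exact: unitaryM (Spu t) Vpu|exact: unitaryM (Smu t) Vmu|].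
  by rewrite adjM mulmxA -(mulmxA (Sp t)) VpVm mulmx0 mul0mx.
have /choice[W WP] t : exists W : 'M[C]_d, W \is unitarymx /\
    loewner_le (herm (H t) (block_fun (bp t) (bm t)))
      (W *m herm (U t) (fun i => f (a t i)) *m W^H).
  have [|W Wu leW] := @herm_dominated _ _ _ (H t) (block_fun (bp t) (bm t)) (U t)
     (fun i => f (a t i)) epq (Hu t) (Uu t).
    by move=> s; rewrite block_fun_card envelope_card ?epq.
  by exists W.
exists W => [t|]; first by case: (WP t).
apply: (loewner_le_trans (B := \sum_t (alpha t)%:C *: herm (H t) (block_fun (bp t) (bm t)))).
  rewrite (herm_partition up).
  have -> : \sum_t (alpha t)%:C *: herm (H t) (block_fun (bp t) (bm t)) =
     \sum_t (alpha t)%:C *: herm (Sp t *m Vp) (bp t) +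
     \sum_t (alpha t)%:C *: herm (Sm t *m Vm) (bm t).
    by rewrite -big_split; apply: eq_bigr => t _; rewrite herm_col_mx scalerDr.
  (* On its own block each envelope agrees with [f] at the eigenvalues, so the two left sides add up
     to [herm Q (fun j => f (mu j))] exactly. *)
  have Ep : (fun k => upper_envelope f (mu (kp k))) = (fun k => f (mu (kp k))).
    by apply/funext => k; apply: upper_envelope_eq => //; apply/asboolP/(enum_valP k).
  have Em : (fun k => lower_envelope f (mu (km k))) = (fun k => f (mu (km k))).
    apply/funext => k; apply: lower_envelope_eq => //.
    have := enum_valP k; rewrite inE => /asboolPn nup.
    by case: (convex_nneg_dichotomy fc (mu0 (km k))).
  by move: lep lem; rewrite /= Ep Em; exact: loewner_leD.
exact: (loewner_le_sum al0 (fun t => (WP t).2)).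
Qed.

End UnitaryOrbits.

(** * Horn inequalities *)

Section HornInequality.
Context {R : realType}.
Local Notation C := R[i].

Lemma hermN m d (U : 'M[C]_(m, d)) a : - herm U a = herm U (fun j => - a j).
Proof.
apply/matrixP => i j; rewrite [LHS]mxE (hermE U a) hermE -sumrN; apply: eq_bigr => k _.
by rewrite rmorphN mulrN mulNr.
Qed.

Lemma herm_reindex m d (U : 'M[C]_(m, d)) a (p : 'S_m) :
  herm U a = herm (perm_mx p *m U) (fun j => a (p j)).
Proof.
by rewrite -herm_perm mulmxA adj_perm -perm_mxM mulVg perm_mx1 mul1mx.
Qed.

Lemma eigval_desc_herm d (A : 'M[C]_d) : A \is hermsymmx ->
  (forall j k : 'I_d, (j <= k)%N -> eigval_desc A k <= eigval_desc A j) /\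
  exists2 U : 'M[C]_d, U \is unitarymx & A = herm U (eigval_desc A).
Proof.
move=> hA.
have [p [pd pE]] := sort_perm (fun j => complex.Re (spectral_diag A 0 j)).
split; first by move=> j k jk; rewrite /eigval_desc -!pE; exact: pd.
exists (perm_mx p *m spectralmx A).
  exact: unitaryM (unitary_perm p) (spectral_unitarymx A).
rewrite {1}(spectral_herm hA) (herm_reindex _ _ p); congr herm.
by apply/funext => k; exact: pE.
Qed.

Definition orthonormal d r (l : 'I_r -> 'cV[C]_d) :=
  forall i j, ((l i)^H *m l j) 0 0 = (i == j)%:R.

Lemma orthonormal_free d r (l : 'I_r -> 'cV[C]_d) :
  orthonormal l -> free [tuple l i | i < r].
Proof.
move=> lo; apply/freeP => k sk0 j.
have : ((l j)^H *m (\sum_(i < r) k i *: [tuple l i | i < r]`_i)) 0 0 = 0.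
  by rewrite sk0 mulmx0 mxE.
rewrite mulmx_sumr summxE (bigD1 j) //= big1 => [|i ij].
  by rewrite addr0 -scalemxAr mxE nth_mktuple lo eqxx mulr1.
by rewrite -scalemxAr mxE nth_mktuple lo eq_sym (negPf ij) mulr0.
Qed.

Lemma sqnormZ d (a : R) (v : 'cV[C]_d) : sqnorm (a%:C *: v) = a ^+ 2 * sqnorm v.
Proof.
rewrite /sqnorm mulr_sumr; apply: eq_bigr => i _; rewrite mxE /sqmod.
by case: (v i 0) => x y /=; ring.
Qed.

(** Greedy choice: a space of dimension above [r] meets the orthogonal complement of the [r] vectors
    already chosen, and a nonzero vector there is normalised. The spaces need not be nested. *)
Lemma adapted_frame d r (S : nat -> {vspace 'cV[C]_d}) :
  (forall q, (q < r)%N -> (q < \dim (S q))%N) ->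
  exists l : nat -> 'cV[C]_d,
    (forall q, (q < r)%N -> l q \in S q) /\ orthonormal (fun i : 'I_r => l i).
Proof.
elim: r => [|r IH] dimS; first by exists (fun=> 0); split=> // -[].
have [l [lS lo]] := IH (fun q qr => dimS q (ltnW qr)).
pose B : 'M[C]_(r, d) := \matrix_(i, j) (l i)^H 0 j.
(* The kernel of [phi] is the orthogonal complement of the earlier vectors. *)
pose phi := linfun (mulmx B : 'cV[C]_d -> 'cV[C]_r).
have : (0 < \dim (S r :&: lker phi))%N.
  have := limg_ker_dim phi (S r); have := dimS r (ltnSn r).
  have := dimvS (subvf (phi @: S r)); rewrite dimvf dim_matrix mulr1 => le_r lt_r e.
  by rewrite -(ltn_add2r (\dim (phi @: S r))) e add0n (leq_ltn_trans le_r).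
rewrite lt0n dimv_eq0 -vpick0; set v := vpick _ => v0.
have /memv_capP[vS vker] : v \in (S r :&: lker phi)%VS by exact: memv_pick.
have lv (i : 'I_r) : (l i)^H *m v = 0.
  apply/matrixP => a b; rewrite !ord1 [RHS]mxE.
  move: vker; rewrite memv_ker lfunE => /eqP/matrixP/(_ i 0).
  rewrite [RHS]mxE mxE => <-; rewrite mxE; apply: eq_bigr => j _.
  by rewrite [in RHS]mxE.
have n0 := sqnorm_gt0 v0.
pose u := (Num.sqrt (sqnorm v))^-1%:C *: v.
have uu : (u^H *m u) 0 0 = 1.
  rewrite -sqnormE sqnormZ exprVn sqr_sqrtr ?(ltW n0) // mulVf //.
  by rewrite gt_eqF.
have lu (i : 'I_r) : (l i)^H *m u = 0 by rewrite -scalemxAr lv scaler0.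
exists (fun q => if q == r then u else l q); split=> [q|i j].
  rewrite ltnS leq_eqVlt; case: eqP => [-> _|_ /= qr]; first exact: memvZ.
  exact: lS.
have [ei|ni] := eqVneq (i : nat) r; have [ej|nj] := eqVneq (j : nat) r.
- by rewrite uu -val_eqE /= ei ej eqxx.
- have jr : (j < r)%N by rewrite ltn_neqAle nj -ltnS ltn_ord.
  rewrite -[_ *m _]adjK adjM adjK (lu (Ordinal jr)) adj0 mxE.
  by rewrite -val_eqE /= ei eq_sym (negPf nj).
- have ir : (i < r)%N by rewrite ltn_neqAle ni -ltnS ltn_ord.
  by rewrite (lu (Ordinal ir)) mxE -val_eqE /= ej (negPf ni).
have ir : (i < r)%N by rewrite ltn_neqAle ni -ltnS ltn_ord.
have jr : (j < r)%N by rewrite ltn_neqAle nj -ltnS ltn_ord.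
by rewrite (lo (Ordinal ir) (Ordinal jr)) -!val_eqE.
Qed.

Definition frame_mx d r (l : 'I_r -> 'cV[C]_d) : 'M[C]_(d, r) :=
  \matrix_(i, q) l q i 0.

Lemma frame_mxE d r (l l' : 'I_r -> 'cV[C]_d) (A : 'M[C]_d) p q :
  ((frame_mx l)^H *m A *m frame_mx l') p q = ((l p)^H *m A *m l' q) 0 0.
Proof.
rewrite mxE [RHS]mxE; apply: eq_bigr => k _; congr (_ * _); last by rewrite mxE.
rewrite mxE [RHS]mxE; apply: eq_bigr => j _; congr (_ * _).
by rewrite !adjE mxE.
Qed.

Lemma frame_mx_isometry d r (l : 'I_r -> 'cV[C]_d) :
  orthonormal l -> (frame_mx l)^H *m frame_mx l = 1%:M.
Proof.
move=> lo; rewrite -[X in X *m _]mulmx1; apply/matrixP => p q.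
by rewrite frame_mxE mulmx1 lo [RHS]mxE.
Qed.

(** Both sums are the trace of the compression of [A] to [L]: the matrix [S] between two orthonormal
    bases is unitary, and the trace is cyclic. *)
Lemma frame_trace d r (L : {vspace 'cV[C]_d}) (A : 'M[C]_d) (l l' : 'I_r -> 'cV[C]_d) :
  \dim L = r -> orthonormal l -> orthonormal l' ->
  (forall q, l q \in L) -> (forall q, l' q \in L) ->
  \sum_q qform A (l q) = \sum_q qform A (l' q).
Proof.
move=> dL lo lo' lL lL'.
have trE (k : 'I_r -> 'cV[C]_d) :
    \sum_q qform A (k q) = complex.Re (\tr ((frame_mx k)^H *m A *m frame_mx k)).
  rewrite /mxtrace raddf_sum; apply: eq_bigr => q _.
  by rewrite frame_mxE.
have bL : basis_of L [tuple l i | i < r].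
  rewrite basisEfree; apply/and3P; split.
  - exact: orthonormal_free.
  - by apply/span_subvP => v /tnthP[i ->]; rewrite tnth_mktuple.
  - by rewrite size_tuple dL.
pose S : 'M[C]_r := \matrix_(p, q) coord [tuple l i | i < r] p (l' q).
have E' : frame_mx l' = frame_mx l *m S.
  apply/matrixP => i q; rewrite mxE (coord_basis bL (lL' q)) summxE mxE.
  by apply: eq_bigr => p _; rewrite nth_mktuple !mxE mulrC.
have SS : S *m S^H = 1%:M.
  apply: mulmx1C; have := frame_mx_isometry lo'.
  by rewrite E' adjM mulmxA -(mulmxA S^H) (frame_mx_isometry lo) mulmx1.
rewrite !trE E' adjM; congr complex.Re.
set E := frame_mx l.
have -> : S^H *m E^H *m A *m (E *m S) = S^H *m (E^H *m A *m E *m S) by rewrite !mulmxA.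
by rewrite [RHS]mxtrace_mulC -(mulmxA _ S) SS mulmx1.
Qed.

(** * Flags of eigenvectors and the Hersch-Zwahlen bound *)

Definition eigenflag d (U : 'M[C]_d) (i : 'I_d) : {vspace 'cV[C]_d} :=
  <<[tuple col (widen_ord (ltn_ord i) k) U^H | k < i.+1]>>%VS.

Lemma col_adj_mul d (U : 'M[C]_d) i j : U \is unitarymx ->
  (row i U *m col j U^H) 0 0 = (i == j)%:R.
Proof.
move=> /unitaryP/matrixP/(_ i j); rewrite [RHS]mxE => <-.
by rewrite !mxE; apply: eq_bigr => k _; rewrite !mxE.
Qed.

Lemma eigenflag_complete d (U : 'M[C]_d) : U \is unitarymx -> complete_flag (eigenflag U).
Proof.
move=> Uu; split=> [i|i j ij].
  have o : orthonormal (fun k : 'I_i.+1 => col (widen_ord (ltn_ord i) k) U^H).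
    move=> k k'.
    have -> : (col (widen_ord (ltn_ord i) k) U^H)^H = row (widen_ord (ltn_ord i) k) U.
      by apply/matrixP => a b; rewrite adjE mxE adjE conjcK [RHS]mxE.
    by rewrite col_adj_mul // -!val_eqE.
  have := orthonormal_free o; rewrite /free => /eqP; rewrite size_tuple => dE.
  exact: dE.
apply/span_subvP => v /tnthP[k ->]; rewrite tnth_mktuple.
apply/memv_span/tnthP; exists (widen_ord (ij : (i.+1 <= j.+1)%N) k).
by rewrite tnth_mktuple; congr (col _ _); apply/val_inj.
Qed.

Lemma eigenflag_coord d (U : 'M[C]_d) (i k : 'I_d) (v : 'cV[C]_d) :
  U \is unitarymx -> v \in eigenflag U i -> (i < k)%N -> (U *m v) k 0 = 0.
Proof.
move=> Uu vE ik; pose phi := linfun (mulmx (row k U) : 'cV[C]_d -> 'cV[C]_1).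
have /subvP/(_ v vE) : (eigenflag U i <= lker phi)%VS.
  apply/span_subvP => w /tnthP[j ->]; rewrite tnth_mktuple memv_ker lfunE /=.
  apply/eqP/matrixP => a b; rewrite !ord1 col_adj_mul // mxE -val_eqE /=.
  by rewrite gtn_eqF // (leq_trans _ ik) // ltn_ord.
rewrite memv_ker lfunE /= -row_mul => /eqP/matrixP/(_ 0 0).
by rewrite mxE [RHS]mxE.
Qed.

(** Only eigenvalues of index at most [i] contribute, and all of these are at least [a i]. *)
Lemma qform_eigenflag d (U : 'M[C]_d) (a : 'I_d -> R) i v :
  U \is unitarymx -> (forall j k : 'I_d, (j <= k)%N -> a k <= a j) ->
  v \in eigenflag U i -> (v^H *m v) 0 0 = 1 -> a i <= qform (herm U a) v.
Proof.
move=> Uu ad vE v1.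
have n1 : sqnorm v = 1 by apply: complexI; rewrite sqnormE v1.
rewrite qform_herm -[a i]mul1r -n1 -(sqnorm_isometry v (unitary_adjK Uu)) mulr_suml.
apply: ler_sum => k _; have [ki|ik] := leqP k i.
  by apply: ler_wpM2l; [exact: sqmod_ge0|exact: ad].
by rewrite (eigenflag_coord Uu vE ik) /sqmod /= expr0n addr0 !mul0r.
Qed.

(** The Schubert conditions are exactly the dimension bounds of [adapted_frame] for the
    intersections of [L] with the flag; each chosen vector is then bounded by [qform_eigenflag]. *)
Lemma hersch_zwahlen d (U : 'M[C]_d) (a : 'I_d -> R) (K : {set 'I_d})
    (L : {vspace 'cV[C]_d}) :
  U \is unitarymx -> (forall j k : 'I_d, (j <= k)%N -> a k <= a j) ->
  schubert K (eigenflag U) L ->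
  exists l : nat -> 'cV[C]_d,
    [/\ orthonormal (fun q : 'I_#|K| => l q), forall q : 'I_#|K|, l q \in L &
        \sum_(k in K) a k <= \sum_(q < #|K|) qform (herm U a) (l q)].
Proof.
move=> Uu ad [dL dimL].
(* The family is extended from ordinals to [nat]; from [#|K|] on, the default [fullv] leaves [L]
   itself. *)
pose S (q : nat) := (L :&: oapp (fun q : 'I_#|K| => eigenflag U (enum_val q)) fullv (insub q))%VS.
have SE (q : 'I_#|K|) : S q = (L :&: eigenflag U (enum_val q))%VS by rewrite /S valK.
have [|l [lS lo]] := @adapted_frame d #|K| S.
  by move=> q qK; rewrite -[q]/(val (Ordinal qK)) SE; exact: dimL.
have lLE (q : 'I_#|K|) : l q \in L /\ l q \in eigenflag U (enum_val q).
  by have := lS q (ltn_ord q); rewrite SE => /memv_capP.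
exists l; split=> //; first by move=> q; case: (lLE q).
rewrite big_enum_val; apply: ler_sum => q _; apply: qform_eigenflag => //.
  by case: (lLE q).
by rewrite lo eqxx.
Qed.

Lemma horn_trace_le d (n : nat) (alpha : 'I_n -> R) (A : 'M[C]_d) (B : 'I_n -> 'M[C]_d)
    (I : 'I_n -> {set 'I_d}) (K : {set 'I_d}) :
  (forall t, 0 <= alpha t) -> horn_tuple R I K ->
  A \is hermsymmx -> (forall t, B t \is hermsymmx) ->
  forall W : 'I_n -> 'M[C]_d, (forall t, W t \is unitarymx) ->
  loewner_le A (\sum_t (alpha t)%:C *: (W t *m B t *m (W t)^H)) ->
  \sum_(k in K) eigval_desc A k <= \sum_t alpha t * \sum_(i in I t) eigval_desc (B t) i.
Proof.
move=> al0 [r [_ [cI cK horn]]] hA hB W Wu leAB.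
have [ad [U Uu EA]] := eigval_desc_herm hA.
have /choice[V VP] t : exists V : 'M[C]_d, V \is unitarymx /\ B t = herm V (eigval_desc (B t)).
  by have [_ [V Vu EV]] := eigval_desc_herm (hB t); exists V.
(* Upper bounds come from negated matrices. Negation reverses the order of eigenvalues, so [Q t] and
   [e t] form the decreasing spectral decomposition of the negated conjugate of [B t], and the dual
   index set becomes [I t] again. *)
pose rv := perm (@rev_ord_inj d).
pose Q t := perm_mx rv *m (V t *m (W t)^H).
have Qu t : Q t \is unitarymx.
  exact: unitaryM (unitary_perm rv) (unitaryM (VP t).1 (unitary_adj (Wu t))).
pose e t j := - eigval_desc (B t) (rv j).
have EQ t : - (W t *m B t *m (W t)^H) = herm (Q t) (e t).
  rewrite {1}(VP t).2 -{1}[W t]adjK herm_congr hermN.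
  by rewrite (herm_reindex _ _ rv).
have ed t (j k : 'I_d) : (j <= k)%N -> e t k <= e t j.
  move=> jk; rewrite /e lerN2; case: (eigval_desc_herm (hB t)) => + _; apply.
  by rewrite !permE /= leq_sub2l.
have [L [LI LK]] := horn (fun t => eigenflag (Q t)) (eigenflag U)
  (fun t => eigenflag_complete (Qu t)) (eigenflag_complete Uu).
have [l [lo lL le]] := hersch_zwahlen Uu ad LK.
apply: (le_trans le); rewrite -EA.
apply: le_trans (_ :
  \sum_(q < #|K|) qform (\sum_t (alpha t)%:C *: (W t *m B t *m (W t)^H)) (l q) <= _).
  by apply: ler_sum => q _; exact: loewner_le_qform.
under eq_bigr do rewrite qform_sum.
rewrite exchange_big; apply: ler_sum => t _; rewrite -mulr_sumr ler_wpM2l //.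
(* Each [t] brings its own orthonormal basis of [L]; [frame_trace] exchanges it for [l]. *)
have [l' [lo' lL' le']] := hersch_zwahlen (Qu t) (ed t) (LI t).
have cJ : #|dual_index (I t)| = #|K|.
  by rewrite /dual_index card_imset ?cI ?cK //; exact: rev_ord_inj.
rewrite cJ in lo' lL' le'.
have dL : \dim L = #|K| by case: LK.
rewrite (frame_trace _ dL lo lo' lL lL') -lerN2 -!sumrN.
rewrite (eq_bigr (fun q : 'I_#|K| => qform (herm (Q t) (e t)) (l' q))); last first.
  by move=> q _; rewrite -EQ qformN.
apply: le_trans le'; rewrite /dual_index big_imset /=; last by move=> ? ? _ _; exact: rev_ord_inj.
by apply: ler_sum => i _; rewrite /e permE rev_ordK.
Qed.

End HornInequality.

(** * Deduction of the theorem *)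

Lemma convex_function_nneg (R : realType) (f : R -> R) :
  @convex_function R R^o `[0, +oo[%classic f -> convex_nneg f.
Proof.
move=> cf x y t x0 y0 t0 t1.
have t01 : 0 <= t <= 1 by rewrite t0.
have := cf (Itv01 t0 t1) x y; rewrite !convRE /=; apply.
  by rewrite inE /= in_itv /= x0.
by rewrite inE /= in_itv /= y0.
Qed.

Theorem theorem17 (R : realType) (d n : nat)
    (X : 'I_n -> 'M[R[i]]_d) (alpha : 'I_n -> R) (f : R -> R)
    (X_psd : forall t, psdmx (X t))
    (alpha_ge0 : forall t, 0 <= alpha t)
    (alpha_sum1 : \sum_t alpha t = 1)
    (f_ge0 : forall x, 0 <= x -> 0 <= f x)
    (f_convex : @convex_function R R^o `[0, +oo[%classic f) :
  (forall (I : 'I_n -> {set 'I_d}) (K : {set 'I_d}), horn_tuple R I K ->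
     \sum_(k in K) eigval_desc (mxfun f (\sum_t (alpha t)%:C *: X t)) k
     <= \sum_t alpha t * \sum_(i in I t) eigval_desc (mxfun f (X t)) i)
  /\
  (exists U : 'I_n -> 'M[R[i]]_d,
     (forall t, U t \is unitarymx) /\
     loewner_le (mxfun f (\sum_t (alpha t)%:C *: X t))
       (\sum_t (alpha t)%:C *: (U t *m mxfun f (X t) *m (U t)^t*))).
Proof.
have X_herm t : X t \is hermsymmx by case: (X_psd t).
have [M_herm _] := psdmx_sum alpha_ge0 X_psd.
have X_ge0 t i : 0 <= complex.Re (spectral_diag (X t) 0 i).
  move: i; apply: (herm_ge0 (spectral_unitarymx (X t))).
  by rewrite -(spectral_herm (X_herm t)).
have EM : \sum_t (alpha t)%:C *:
    herm (spectralmx (X t)) (fun j => complex.Re (spectral_diag (X t) 0 j))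
  = herm (spectralmx (\sum_t (alpha t)%:C *: X t))
      (fun j => complex.Re (spectral_diag (\sum_t (alpha t)%:C *: X t) 0 j)).
  rewrite -(spectral_herm M_herm); apply: eq_bigr => t _.
  by rewrite -(spectral_herm (X_herm t)).
have [W Wu le_W] := unitary_orbit_bound alpha_ge0 alpha_sum1 f_ge0
  (convex_function_nneg f_convex) (fun t => spectral_unitarymx (X t)) X_ge0
  (spectral_unitarymx _) EM.
have {}le_W : loewner_le (mxfun f (\sum_t (alpha t)%:C *: X t))
    (\sum_t (alpha t)%:C *: (W t *m mxfun f (X t) *m (W t)^H)).
  have -> : \sum_t (alpha t)%:C *: (W t *m mxfun f (X t) *m (W t)^H)
    = \sum_t (alpha t)%:C *: (W t *m herm (spectralmx (X t))
        (fun j => f (complex.Re (spectral_diag (X t) 0 j))) *m (W t)^H).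
    by apply: eq_bigr => t _; rewrite -mxfunE.
  by rewrite mxfunE.
have mxfun_herm (A : 'M[R[i]]_d) : mxfun f A \is hermsymmx.
  by rewrite mxfunE; exact: herm_is_hermsymmx.
(* The Horn inequalities are deduced from the Loewner inequality with the same unitaries [W]. *)
split; last by exists W.
move=> I K horn.
exact: (horn_trace_le alpha_ge0 horn (mxfun_herm _) (fun t => mxfun_herm _) Wu le_W).
Qed.
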